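(* Let $\omega>0$, and assume that there exists a solution of $$\partial_t u(x,t)=\partial_x^2u(x,t)+\int_{\mathbb{R}}\big(u(y,t)-\Theta\big)_+\,K(x-y)\,dy,\qquad x\in\mathbb{R},\ t\in\mathbb{R},$$ of the form $$u(x,t)=v(x+\omega t)+\Theta$$ for some $v:\mathbb{R}\to\mathbb{R}$, with $v(0)=0$ and $v'(0)=\kappa\in(0,+\infty)$. Then $$v'(x)\ge\kappa e^{\omega x}\ \text{ for all }x\in(-\infty,0)\qquad\text{and}\qquad v'(x)\le\kappa e^{\omega x}\ \text{ for all }x\in[0,+\infty).$$ However, if there exist $\lambda,\varrho>0$ such that, for all $r\in\mathbb{R}$, $$K(r)\ge\lambda\,\chi_{(-\varrho,\varrho)}(r),$$ then there cannot exist $\kappa_\star\in(0,+\infty)$ such that $v'(x)\ge\kappa_\star e^{\omega x}$ for all $x\in[0,+\infty)$.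
   Context: Here $\Theta\in\mathbb{R}$, $r_+:=\max\{r,0\}$, $\chi_A$ is the characteristic function of the set $A$, and $K:\mathbb{R}\to[0,+\infty)$ is nonnegative and integrable. Solutions are classical: $u$ is continuously differentiable in $t$ and twice continuously differentiable in $x$, so that $v\in C^2(\mathbb{R})$, the integral is finite, and the equation holds pointwise. *)

(* Defs.v *)
From HB Require Import structures.
From mathcomp Require Export all_boot all_order all_algebra.
From mathcomp Require Export all_classical all_reals all_analysis.
Export Order.TTheory GRing.Theory Num.Theory.
Export numFieldNormedType.Exports.

Set Implicit Arguments.
Unset Strict Implicit.
Unset Printing Implicit Defensive.

Local Open Scope ring_scope.
Local Open Scope classical_set_scope.

(* [f^`(k)] is total in Rocq, hence the explicit derivability of all the
   derivatives of order less than n. *)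
Definition class_C (R : realType) (n : nat) (f : R -> R) : Prop :=
  (forall k, (k < n)%N -> forall x, derivable f^`(k) x 1) /\
  continuous f^`(n).

(* Measurability and integrals on the line are taken with respect to the
   completed Lebesgue measure: the library's [lebesgue_measure] only lives on
   the Borel sigma-algebra and would force the kernel to be Borel. *)
Definition Leb_integrable (R : realType) (f : R -> R) : Prop :=
  (@completed_lebesgue_measure R).-integrable setT (EFin \o f).

Definition Leb_integral (R : realType) (f : R -> R) : R :=
  Rintegral (@completed_lebesgue_measure R) setT f.

(* [u x t] is the state at position x and time t; [u x] is thus a function of
   time and [u^~ t] a function of space. *)
Definition source (R : realType) (Theta : R) (K : R -> R) (u : R -> R -> R)
    (x t : R) : R -> R :=
  fun y => Num.max (u y t - Theta) 0 * K (x - y).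

Definition classical_solution (R : realType) (Theta : R) (K : R -> R)
    (u : R -> R -> R) : Prop :=
  [/\ forall x, class_C 1 (u x),
      forall t, class_C 2 (u^~ t),
      forall x t, Leb_integrable (source Theta K u x t) &
      forall x t, derive1 (u x) t =
        derive1n 2 (u^~ t) x + Leb_integral (source Theta K u x t)].

(* Main.v *)
Require Import Defs.
From mathcomp Require Import all_boot all_order all_algebra.
From mathcomp Require Import all_classical all_reals all_analysis.
From mathcomp Require Import ring lra.

Local Open Scope ring_scope.
Local Open Scope classical_set_scope.

(** At time 0 the equation for u reads v'' = omega * v' - I, where I x is the
integral of max (v y) 0 * K (x - y) over y. Multiplying by the integrating
factor of the linear part, the damped slope w x = exp (- omega * x) * v' x
satisfies w' x = - exp (- omega * x) * I x. Since K >= 0 this is nonpositive,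
so w is nonincreasing ([damped_slope_nincr]), and comparing w x with
w 0 = kappa on either side of 0 gives the two exponential bounds.

Suppose now that K >= lambda on (- rho, rho) and that v' x >= k * exp (omega * x)
for x >= 0, that is, w >= k there. Integrating, v grows at least like
(k / omega) * (exp (omega * x) - 1) ([wave_ge]). The values of v on
(x, x + rho) alone then force I x to be at least a fixed multiple of
exp (omega * x) for x >= 1 ([reaction_ge]). The integrating factor cancels
that growth exactly, so w' <= - c on [1, +oo) for some c > 0, and w decreases
at least linearly: it cannot stay above k > 0 ([expR_not_le_slope]). *)

(** Comparing two increments takes a single application of the mean value
theorem, to g - f; it replaces every integration of a derivative below. *)
Lemma le_increment (R : realType) (f g df dg : R -> R) (a b : R) : a <= b ->
  (forall x : R, is_derive x 1 f (df x)) ->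
  (forall x : R, is_derive x 1 g (dg x)) ->
  (forall x, a <= x <= b -> df x <= dg x) ->
  f b - f a <= g b - g a.
Proof.
move=> ab f' g' le_df.
have h' (x : R) : is_derive x 1 (g - f) (dg x - df x) by exact: is_deriveB.
have [|c] := @MVT_segment R (g - f) (fun x => dg x - df x) a b ab
  (fun x _ => h' x).
  apply: continuous_subspaceT => x.
  by apply/differentiable_continuous/derivable1_diffP; case: (h' x).
rewrite in_itv /= => /le_df le_dfc; rewrite !fctE => eq_c.
have : 0 <= (dg c - df c) * (b - a) by rewrite mulr_ge0 ?subr_ge0.
by rewrite -eq_c; lra.
Qed.

(** Lebesgue measure and its completion restrict the same outer measure to two
sigma-algebras, so the value known on Borel sets carries over. *)
Lemma completed_lebesgue_measure_itvoo (R : realType) (a b : R) : a <= b ->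
  completed_lebesgue_measure `]a, b[%classic = (b - a)%:E.
Proof.
move=> ab.
transitivity (@lebesgue_measure R `]a, b[%classic); first by [].
rewrite lebesgue_measure_itv /= lte_fin.
by case: ltgtP ab => // -> _; rewrite subrr.
Qed.

(** Turns a pointwise lower bound on a window into a lower bound on the whole
integral: f dominates the function equal to c on the window and 0 outside. *)
Lemma Leb_integral_ge_itv (R : realType) (f : R -> R) (c a b : R) : a <= b ->
  Leb_integrable f -> (forall y, 0 <= f y) ->
  (forall y, a < y < b -> c <= f y) ->
  c * (b - a) <= Leb_integral f.
Proof.
move=> ab f_int f_ge0 le_cf.
pose mu := @completed_lebesgue_measure R.
have mD : ((wlength (@idfun R))^*%mu).-cara.-measurable (`]a, b[%classic : set R).
  apply: sub_caratheodory; exact: (@measurable_itv R).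
have c_int : mu.-integrable setT (EFin \o ((fun=> c) \_ `]a, b[)).
  rewrite -restrict_EFin; apply/(integrable_mkcond _ mD)/integrableP; split.
    exact: measurable_cst.
  rewrite (integral_cst mu mD `|c|%:E).
  by rewrite [X in (_ * X)%E](completed_lebesgue_measure_itvoo _ _ _ ab) -EFinM ltry.
have -> : c * (b - a) = Rintegral mu `]a, b[ (fun=> c).
  by rewrite Rintegral_cst// [X in fine X](completed_lebesgue_measure_itvoo _ _ _ ab).
rewrite Rintegral_mkcond; apply: le_Rintegral => // x _.
rewrite patchE; case: ifPn => // /set_mem /=.
by rewrite in_itv /= => /le_cf.
Qed.

Lemma is_derive_mull (R : realType) (a x : R) :
  is_derive x 1 (fun y => a * y) a.
Proof.
have := is_deriveZ a (is_derive_id x (1 : R)).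
by rewrite /GRing.scale /= mulr1.
Qed.

Lemma is_derive_expRM (R : realType) (a x : R) :
  is_derive x 1 (fun y => expR (a * y)) (a * expR (a * x)).
Proof.
rewrite mulrC.
exact: (is_derive1_comp (is_derive_expR (a * x)) (is_derive_mull _ a x)).
Qed.

Section traveling_wave.
Variables (R : realType) (Theta : R) (K : R -> R) (omega : R).
Variables (u : R -> R -> R) (v : R -> R).
Hypothesis K_ge0 : forall r, 0 <= K r.
Hypothesis u_sol : classical_solution Theta K u.
Hypothesis u_wave : forall x t, u x t = v (x + omega * t) + Theta.

Let reaction (x : R) : R := Leb_integral (source Theta K u x 0).

Lemma wave_source (x y : R) :
  source Theta K u x 0 y = Num.max (v y) 0 * K (x - y).
Proof. by rewrite /source u_wave mulr0 addr0 addrK. Qed.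

Lemma wave_source_ge0 (x y : R) : 0 <= source Theta K u x 0 y.
Proof. by rewrite wave_source mulr_ge0// le_max lexx orbT. Qed.

Lemma reaction_ge0 (x : R) : 0 <= reaction x.
Proof. by apply: Rintegral_ge0 => y _; exact: wave_source_ge0. Qed.

Let u0E : u^~ 0 = v + cst Theta.
Proof. by apply/funext => x; rewrite u_wave mulr0 addr0. Qed.

Lemma is_derive_wave (x : R) : is_derive x 1 v (derive1 v x).
Proof.
have [_ uC2 _ _] := u_sol.
have /(_ 0%N isT x) := (uC2 0).1.
rewrite derive1n0 u0E => dvT.
rewrite derive1E; apply: derivableP.
rewrite (_ : v = v + cst Theta - cst Theta); first exact: derivableB.
by apply/funext => y; rewrite !fctE addrK.
Qed.

Let derive1_u0 : derive1 (u^~ 0) = derive1 v.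
Proof.
apply/funext => x; rewrite u0E !derive1E deriveD//.
- by rewrite derive_cst addr0.
- by case: (is_derive_wave x).
Qed.

Let derive1_ut (x : R) : derive1 (u x) 0 = omega * derive1 v x.
Proof.
have -> : u x = (v \o (fun t => x + omega * t)) + cst Theta.
  by apply/funext => t; rewrite u_wave.
have aff : is_derive (0 : R) 1 (fun t : R => x + omega * t) omega.
  have c' : is_derive (0 : R) 1 (cst x : R -> R) 0 by exact: is_derive_cst.
  by have := is_deriveD c' (is_derive_mull _ omega 0); rewrite add0r.
have vx : is_derive (x + omega * 0) 1 v (derive1 v x).
  by rewrite mulr0 addr0; exact: is_derive_wave.
have vaff := @is_derive1_comp R v (fun t => x + omega * t) 0 _ _ vx aff.
rewrite derive1E; apply: derive_val.
by apply: is_derive_eq; rewrite addr0 mulrC.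
Qed.

(** The time derivative of u at time 0 is omega * v', which turns the evolution
equation into an ordinary differential equation for the profile. *)
Lemma is_derive2_wave (x : R) :
  is_derive x 1 (derive1 v) (omega * derive1 v x - reaction x).
Proof.
have [_ uC2 _ uE] := u_sol.
have /(_ 1%N isT x) := (uC2 0).1.
rewrite derive1n1 derive1_u0 => /derivableP; rewrite -derive1E.
have := uE x 0; rewrite derive1_ut derive1nS derive1n1 derive1_u0 => ->.
by rewrite addrK.
Qed.

Let w (x : R) := expR (- omega * x) * derive1 v x.

(** The factor exp (- omega * x) is chosen to cancel the term omega * v' of the
profile equation, so that only the reaction term survives. *)
Lemma is_derive_damped_slope (x : R) :
  is_derive x 1 w (- (expR (- omega * x) * reaction x)).
Proof.
have E' := is_derive_expRM _ (- omega) x.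
have v' := is_derive2_wave x.
apply: is_derive_eq (is_deriveM E' v') _.
by rewrite /GRing.scale /=; ring.
Qed.

Lemma damped_slope_nincr (x y : R) : x <= y -> w y <= w x.
Proof.
move=> xy; rewrite -subr_le0.
have c' (z : R) : is_derive z 1 (cst 0 : R -> R) 0 by exact: is_derive_cst.
have := le_increment _ _ _ _ _ _ _ xy is_derive_damped_slope c'.
rewrite !fctE subrr; apply => z _.
by rewrite oppr_le0 mulr_ge0 ?expR_ge0 ?reaction_ge0.
Qed.

(** Only the window (x, x + rho) to the right of x is used: there x - y lies in
(- rho, 0), where the kernel is at least lambda. *)
Lemma reaction_ge (lambda rho m x : R) : 0 <= lambda -> 0 <= rho -> 0 <= m ->
  (forall r, lambda * \1_(`]- rho, rho[%classic) r <= K r) ->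
  (forall y, x < y < x + rho -> m <= v y) ->
  m * lambda * rho <= reaction x.
Proof.
move=> lambda_ge0 rho_ge0 m_ge0 leK le_mv.
have [_ _ u_int _] := u_sol.
have -> : m * lambda * rho = m * lambda * (x + rho - x) by ring.
apply: Leb_integral_ge_itv => // [||y xy].
- by rewrite lerDl.
- exact: wave_source_ge0.
rewrite wave_source ler_pM// ?le_max ?le_mv//.
have := leK (x - y); rewrite indicE mem_set ?mulr1//= in_itv/=.
by move: xy => /andP[? ?]; apply/andP; split; lra.
Qed.

Hypothesis omega_gt0 : 0 < omega.
Hypothesis v0 : v 0 = 0.

(** The bound is the antiderivative of k * exp (omega * y) vanishing at 0, where
v vanishes too. *)
Lemma wave_ge (k x : R) :
  (forall y, 0 <= y -> k * expR (omega * y) <= derive1 v y) -> 0 <= x ->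
  k / omega * (expR (omega * x) - 1) <= v x.
Proof.
move=> le_kv x_ge0.
have E' (z : R) : is_derive z 1 (fun y => k / omega * expR (omega * y))
    (k * expR (omega * z)).
  have E := is_deriveZ (k / omega) (is_derive_expRM _ omega z).
  apply: is_derive_eq E _; rewrite /GRing.scale /=.
  by field; rewrite gt_eqF.
have := le_increment _ _ _ _ _ _ _ x_ge0 E' is_derive_wave.
rewrite v0 subr0 mulr0 expR0 mulrBr; apply => z /andP[z_ge0 _].
exact: le_kv.
Qed.

(** A slope of order exp (omega * x) would feed back, through the reaction, a
loss of the same order, which makes the damped slope decrease at a uniform
rate and eventually become negative. *)
Lemma expR_not_le_slope (lambda rho k : R) :
  0 < lambda -> 0 < rho -> 0 < k ->
  (forall r, lambda * \1_(`]- rho, rho[%classic) r <= K r) ->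
  ~ (forall x, 0 <= x -> k * expR (omega * x) <= derive1 v x).
Proof.
move=> lambda_gt0 rho_gt0 k_gt0 leK le_kv.
have ko_gt0 : 0 < k / omega by rewrite divr_gt0.
(* Away from 0 the factor exp (omega * x) - 1 is comparable to exp (omega * x):
   for x >= 1 their ratio is at least 1 - exp (- omega). *)
pose c := k / omega * (1 - expR (- omega)) * lambda * rho.
have c_gt0 : 0 < c.
  have : 0 < 1 - expR (- omega) by rewrite subr_gt0 expR_lt1 oppr_lt0.
  by move=> ?; do 3![apply: mulr_gt0 => //].
have v_ge x y : 0 <= x -> x <= y -> k / omega * (expR (omega * x) - 1) <= v y.
  move=> x_ge0 xy; apply: le_trans (wave_ge _ _ le_kv (le_trans x_ge0 xy)).
  by rewrite ler_pM2l// lerD2r ler_expR ler_pM2l.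
have w'_le x : 1 <= x -> - (expR (- omega * x) * reaction x) <= - c.
  move=> x_ge1; have x_ge0 : 0 <= x by lra.
  have ex : expR (- omega * x) * expR (omega * x) = 1.
    by rewrite -expRD mulNr addNr expR0.
  have e1 : expR (- omega * x) <= expR (- omega).
    by rewrite ler_expR !mulNr lerN2 ler_peMr// ltW.
  pose m := k / omega * (expR (omega * x) - 1).
  have m_ge0 : 0 <= m.
    apply: mulr_ge0; first exact: ltW.
    by rewrite subr_ge0 -expR0 ler_expR mulr_ge0// ltW.
  have := reaction_ge _ _ _ x (ltW lambda_gt0) (ltW rho_gt0) m_ge0 leK.
  move=> /(_ (fun y xy => v_ge x y x_ge0 (ltW (proj1 (andP xy))))) le_react.
  rewrite lerN2; apply: le_trans (ler_wpM2l (expR_ge0 _) le_react).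
  have -> : expR (- omega * x) * (m * lambda * rho) =
      k / omega * (1 - expR (- omega * x)) * lambda * rho.
    rewrite -[in RHS]ex /m; ring.
  by rewrite /c !ler_pM2r// ler_pM2l// lerD2l lerN2.
have le_w x : 0 <= x -> k <= w x.
  move=> x_ge0; have := ler_wpM2l (expR_ge0 (- omega * x)) (le_kv x x_ge0).
  by rewrite mulrCA -expRD mulNr addNr expR0 mulr1 -mulNr.
(* The line of slope - c through (1, w 1) vanishes at x1. *)
pose x1 := 1 + w 1 / c.
have x1_ge1 : 1 <= x1.
  by rewrite lerDl divr_ge0 ?(ltW c_gt0)// (le_trans (ltW k_gt0))// le_w.
have := le_increment _ _ _ _ _ _ _ x1_ge1 is_derive_damped_slope
  (is_derive_mull _ (- c)).
move=> /(_ (fun z z1 => w'_le z (proj1 (andP z1)))).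
have -> : - c * x1 - - c * 1 = - w 1.
  by rewrite /x1; field; rewrite gt_eqF.
have := le_w x1 (le_trans ler01 x1_ge1).
by lra.
Qed.

End traveling_wave.

Theorem theorem2p10 (R : realType) (Theta : R) (K : R -> R)
    (K_ge0 : forall r : R, 0 <= K r) (K_int : Leb_integrable K)
    (omega : R) (omega_gt0 : 0 < omega)
    (u : R -> R -> R) (v : R -> R) (kappa : R)
    (u_sol : classical_solution Theta K u)
    (u_wave : forall x t : R, u x t = v (x + omega * t) + Theta)
    (v0 : v 0 = 0) (dv0 : derive1 v 0 = kappa) (kappa_gt0 : 0 < kappa) :
  [/\ forall x : R, x < 0 -> kappa * expR (omega * x) <= derive1 v x,
      forall x : R, 0 <= x -> derive1 v x <= kappa * expR (omega * x) &
      (exists lambda rho : R, [/\ 0 < lambda, 0 < rho &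
         forall r : R, lambda * \1_(`]- rho, rho[%classic) r <= K r]) ->
      ~ (exists kappa_star : R, 0 < kappa_star /\
           forall x : R, 0 <= x -> kappa_star * expR (omega * x) <= derive1 v x)].
Proof.
have w_nincr := damped_slope_nincr _ _ _ _ _ _ K_ge0 u_sol u_wave.
(* The damped slope carries the same information as v', so its monotonicity
   gives both bounds by comparison with its value kappa at 0. *)
have undamp x :
    derive1 v x = expR (- omega * x) * derive1 v x * expR (omega * x).
  by rewrite mulrAC -expRD mulNr addNr expR0 mul1r.
have w0 : expR (- omega * 0) * derive1 v 0 = kappa.
  by rewrite mulr0 expR0 mul1r.
split=> [x x_lt0|x x_ge0|].
- by rewrite undamp ler_pM2r ?expR_gt0// -w0 w_nincr// ltW.
- by rewrite undamp ler_pM2r ?expR_gt0// -w0 w_nincr.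
- move=> [lambda [rho [lambda_gt0 rho_gt0 leK]]] [k [k_gt0]].
  exact: (expR_not_le_slope _ _ _ _ _ _ K_ge0 u_sol u_wave omega_gt0 v0 lambda rho).
Qed.
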